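(* For all integers $l\ge1$ (type $A_l$), $l\ge2$ (type $B_l$) and $l\ge4$ (type $D_l$) respectively, the skew-growth functions of the dual Artin monoids satisfy \[ tN_{G^{dual +}_{A_l}}(t) = \frac{1}{l!} \frac{d^{l-1}}{dt^{l-1}}\Big[ t^l(1-t)^l \Big],\qquad N_{G^{dual +}_{B_{l}}}(t) = \frac{1}{(l-1)!} \frac{d^{l-1}}{dt^{l-1}}\Big[ t^{l-1}(1-t)^l \Big], \] \[ N_{G^{dual +}_{D_{l}}}(t) = \frac{1}{(l-2)!}\frac{d^{l-2}}{dt^{l-2}}\Big[ t^{l-2}(1-t)^{l} \Big] + \frac{1}{(l-3)!}\frac{d^{l-3}}{dt^{l-3}}\Big[ t^{l-1}(1-t)^{l-2} \Big] = \frac{1}{(l-2)!}\frac{d^{l-3}}{dt^{l-3}}\Big[ t^{l-3}(1-t)^{l-2} \big\{(l-2) - (3l-4)t + (3l-4)t^2 \big\} \Big]. \]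
   Context: For a finite Coxeter type $P$ with Coxeter system $(W,S)$, set of reflections $T$ (conjugates of elements of $S$), reflection length $\ell_T$, order $g\le_T h\iff \ell_T(g)+\ell_T(g^{-1}h)=\ell_T(h)$, and bipartite Coxeter element $c$, the dual Artin monoid $G^{dual+}_P$ is the monoid generated by $T$ with relations $r\cdot s=(rsr^{-1})\cdot r$ for all $r,s\in T$ with $rs\le_T c$. It is graded by word length $\deg$ and is a lattice for left divisibility. Its skew-growth function is $N_{G^{dual+}_P}(t)=\sum_{J\subseteq T}(-1)^{|J|}t^{\deg(\mathrm{lcm}(J))}$ (lcm = least common multiple for left divisibility, lcm of $\emptyset$ is $1$). It is known that these are the polynomials $N_{G^{dual +}_{A_l}}(t)=\sum_{k=0}^{l} (-1)^{k}\frac{1}{l}\binom {l}{k}\binom {l+k}{k+1}t^k$, $N_{G^{dual +}_{B_l}}(t)=\sum_{k=0}^{l} (-1)^{k}\binom {l}{k}\binom {l+k-1}{k}t^k$, $N_{G^{dual +}_{D_l}}(t)=\sum_{k=0}^{l} (-1)^{k} \big( \binom {l}{k}\binom {l+k-2}{k} + \binom {l-2}{k-2}\binom {l+k-3}{k}\big) t^k$. *)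

(* Defs.v *)
From HB Require Import structures.
From mathcomp Require Import all_boot all_order all_fingroup all_algebra.
From mathcomp Require Import boolp classical_sets.

Set Implicit Arguments.
Unset Strict Implicit.
Unset Printing Implicit Defensive.

Import GRing.Theory.
Local Open Scope ring_scope.
Local Open Scope quotient_scope.

(* Coxeter matrices.  The nodes of the diagram are 0, ..., l-1.              *)
(*   A_l : the path 0 - 1 - ... - (l-1);                                     *)
(*   B_l : the same path, with its last edge labelled 4;                     *)
(*   D_l : the path 0 - 1 - ... - (l-2), and l-1 joined to l-3.              *)

Definition path_edge (i j : nat) : bool := (i.+1 == j) || (j.+1 == i).

Definition cox_A (l : nat) (i j : 'I_l) : nat :=
  if i == j then 1%N else if path_edge i j then 3%N else 2%N.

Definition cox_B (l : nat) (i j : 'I_l) : nat :=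
  if i == j then 1%N
  else if path_edge i j then (if maxn i j == l.-1 then 4%N else 3%N)
  else 2%N.

Definition edge_D (l i j : nat) : bool :=
  let a := minn i j in let b := maxn i j in
  if b == l.-1 then a == (l - 3)%N else a.+1 == b.

Definition cox_D (l : nat) (i j : 'I_l) : nat :=
  if i == j then 1%N else if edge_D l i j then 3%N else 2%N.

Section CoxeterSystems.
Local Open Scope group_scope.

Definition coxeter_relations (l : nat) (m : 'I_l -> 'I_l -> nat)
    (G : groupType) (s : 'I_l -> G) : Prop :=
  forall i j, (s i * s j) ^+ m i j = 1.

(* gT is the group presented by the generators s and the Coxeter relations;  *)
(* the test groups G range over all groups, finite or not.                   *)
Definition coxeter_system (l : nat) (m : 'I_l -> 'I_l -> nat)
    (gT : finGroupType) (s : 'I_l -> gT) : Prop :=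
  [/\ coxeter_relations m s,
      <<[set s i | i : 'I_l]>> = [set: gT]
    & forall (G : groupType) (f : 'I_l -> G), coxeter_relations m f ->
        exists phi : gT -> G,
          {morph phi : x y / x * y} /\ (forall i, phi (s i) = f i)].

(* c is the product of the two colour classes B and ~: B of a bipartition of *)
(* the Coxeter diagram; the order inside a class is immaterial.              *)
Definition bipartite_coxeter_element (l : nat) (gT : finGroupType)
    (s : 'I_l -> gT) (c : gT) : Prop :=
  exists B : {set 'I_l},
    [/\ forall i j, i \in B -> j \in B -> commute (s i) (s j),
        forall i j, i \notin B -> j \notin B -> commute (s i) (s j)
      & c = (\prod_(i in B) s i) * (\prod_(i in ~: B) s i)].

Variables (l : nat) (gT : finGroupType) (s : 'I_l -> gT).

Definition reflections : {set gT} :=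
  [set s i ^ w | i : 'I_l, w : gT].

(* reflections ^+ k is the set of products of k reflections; a shortest such *)
(* expression has fewer than #|gT| factors, so the default #|gT| is only     *)
(* reached when the reflections do not generate gT.                          *)
Definition refl_length (g : gT) : nat :=
  \big[minn/#|gT|]_(k < #|gT| | g \in reflections ^+ k) k.

Definition refl_le (g h : gT) : bool :=
  (refl_length g + refl_length (g^-1 * h) == refl_length h)%N.

Definition reflection : finType := {t : gT | t \in reflections}.

End CoxeterSystems.

Section DualArtinMonoid.
Variables (l : nat) (gT : finGroupType) (s : 'I_l -> gT) (c : gT).
Local Notation T := (reflection s).

Inductive dual_cong : seq T -> seq T -> Prop :=
| dual_cong_rel (r u v : T) :
    refl_le s (val r * val u)%g c ->
    val v = (val r * val u * (val r)^-1)%g ->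
    dual_cong [:: r; u] [:: v; r]
| dual_cong_refl a : dual_cong a a
| dual_cong_sym a b : dual_cong a b -> dual_cong b a
| dual_cong_trans a b d : dual_cong a b -> dual_cong b d -> dual_cong a d
| dual_cong_cat a a' b b' :
    dual_cong a a' -> dual_cong b b' -> dual_cong (a ++ b) (a' ++ b').

Definition dual_congb : rel (seq T) := fun a b => `[< dual_cong a b >].

Lemma dual_congb_equiv : equiv_class_of dual_congb.
Proof.
split=> [a|a b|b a d].
- exact/asboolP/dual_cong_refl.
- by apply/asboolP/asboolP; apply: dual_cong_sym.
- by move=> /asboolP ab /asboolP bd; apply/asboolP; apply: dual_cong_trans bd.
Qed.

Canonical dual_cong_equiv := EquivRelPack dual_congb_equiv.

Definition dual_artin : Type := {eq_quot dual_cong_equiv}.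

HB.instance Definition _ := Choice.on dual_artin.
HB.instance Definition _ := EqQuotient.on dual_artin.

(* The unqualified name repr is taken by fingroup.                          *)
Local Notation rep := generic_quotient.repr.

Definition dual_artin_one : dual_artin := \pi_dual_artin [::].
Definition dual_artin_mul (x y : dual_artin) : dual_artin :=
  \pi_dual_artin (rep x ++ rep y).

Lemma dual_piP (a b : seq T) :
  \pi_dual_artin a = \pi_dual_artin b <-> dual_cong a b.
Proof.
split; first by move/eqmodP => /asboolP.
by move=> ab; apply/eqmodP/asboolP.
Qed.

Lemma dual_repr_pi (a : seq T) : dual_cong (rep (\pi_dual_artin a)) a.
Proof. by apply/dual_piP; rewrite reprK. Qed.

Lemma dual_piK (x : dual_artin) : \pi_dual_artin (rep x) = x.
Proof. exact: reprK. Qed.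

Lemma dual_artin_mul_pi (a b : seq T) :
  dual_artin_mul (\pi_dual_artin a) (\pi_dual_artin b) = \pi_dual_artin (a ++ b).
Proof. by apply/dual_piP/dual_cong_cat; apply: dual_repr_pi. Qed.

Lemma dual_artin_mulA : associative dual_artin_mul.
Proof.
move=> x y z; rewrite -(dual_piK x) -(dual_piK y) -(dual_piK z).
by rewrite !dual_artin_mul_pi catA.
Qed.

Lemma dual_artin_mul1 : left_id dual_artin_one dual_artin_mul.
Proof. by move=> x; rewrite -(dual_piK x) dual_artin_mul_pi. Qed.

Lemma dual_artin_mulr1 : right_id dual_artin_one dual_artin_mul.
Proof. by move=> x; rewrite -(dual_piK x) dual_artin_mul_pi cats0. Qed.

HB.instance Definition _ := isMonoid.Build dual_artin
  dual_artin_mulA dual_artin_mul1 dual_artin_mulr1.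

Definition dual_gen (t : T) : dual_artin := \pi_dual_artin [:: t].

Definition dual_deg (x : dual_artin) : nat := size (rep x).

Lemma dual_cong_size (a b : seq T) : dual_cong a b -> size a = size b.
Proof.
elim=> // [a' b' d _ -> _ -> //|a1 a2 b1 b2 _ ea _ eb].
by rewrite !size_cat ea eb.
Qed.

Lemma dual_deg_pi (a : seq T) : dual_deg (\pi_dual_artin a) = size a.
Proof. exact: dual_cong_size (dual_repr_pi a). Qed.

Definition ldvd (x y : dual_artin) : Prop := exists z, y = (x * z)%g.

Definition is_lcm (J : {set T}) (m : dual_artin) : Prop :=
  (forall t, t \in J -> ldvd (dual_gen t) m) /\
  (forall m', (forall t, t \in J -> ldvd (dual_gen t) m') -> ldvd m m').

(* ldvd is antisymmetric, because degrees add up and only 1 has degree 0, so *)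
(* lcms are unique; the default 1 is never used for the bipartite Coxeter    *)
(* elements, where the dual Artin monoid is a lattice.                       *)
Definition dual_lcm (J : {set T}) : dual_artin :=
  xget 1%g [set m | is_lcm J m]%classic.

Definition skew_growth : {poly rat} :=
  \sum_(J : {set T}) (-1) ^+ #|J| *: 'X^(dual_deg (dual_lcm J)).

End DualArtinMonoid.

Definition explicit_A (l : nat) : {poly rat} :=
  \sum_(k < l.+1)
     ((-1) ^+ k * (l%:R^-1 * ('C(l, k) * 'C(l + k, k.+1))%:R)) *: 'X^k.

Definition explicit_B (l : nat) : {poly rat} :=
  \sum_(k < l.+1) ((-1) ^+ k * ('C(l, k) * 'C(l + k - 1, k))%:R) *: 'X^k.

(* The test k < 2 is there because 'C(l-2, k-2) must vanish for k < 2,       *)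
(* whereas truncated subtraction would give 'C(l-2, 0) = 1.                  *)
Definition explicit_D (l : nat) : {poly rat} :=
  \sum_(k < l.+1)
     ((-1) ^+ k *
      ('C(l, k) * 'C(l + k - 2, k) +
       (if (k < 2)%N then 0 else 'C(l - 2, k - 2) * 'C(l + k - 3, k)))%:R)
     *: 'X^k.

(* Main.v *)
(* Since p^`N(n) = p^`(n) / n!, each right-hand side is a normalised derivative
   of t^a (1 - t)^m; expanding (1 - t)^m binomially turns it into a sum of
   terms (-1)^k C(m, k) C(a + k, n) t^(a + k - n), which are compared with the
   known explicit polynomials.  The last equality for D_l comes from carrying
   out one of the l - 2 derivatives in its first summand. *)

Require Import Defs.
From HB Require Import structures.
From mathcomp Require Import all_boot all_order all_fingroup all_algebra.
From mathcomp Require Import ring.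

Import GRing.Theory.
Local Open Scope ring_scope.

(** Where [a + k < n] the truncated exponent is harmless: the coefficient ['C(a + k, n)] is zero. *)
Lemma nderivn_Xn_1subX (R : comNzRingType) (a m n : nat) :
  ('X^a * (1 - 'X) ^+ m : {poly R})^`N(n) =
  \sum_(k < m.+1)
     ((-1) ^+ k * ('C(m, k) * 'C(a + k, n))%:R) *: 'X^(a + k - n).
Proof.
rewrite exprBn mulr_sumr linear_sum /=; apply: eq_bigr => k _.
rewrite expr1n mulr1 [in LHS]mulrnAr mulrCA -exprD.
rewrite -polyC1 -polyCN -polyC_exp mul_polyC nderivnMn nderivnZ nderivnXn.
by rewrite -!scaler_nat !scalerA natrM mulrCA mulrA.
Qed.

Lemma scale_derivn (n : nat) (p : {poly rat}) : (n`!%:R)^-1 *: p^`(n) = p^`N(n).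
Proof.
rewrite nderivn_def -scaler_nat scalerA mulVf ?scale1r //.
by rewrite Num.Theory.pnatr_eq0 -lt0n fact_gt0.
Qed.

Lemma explicit_A_derivn (l : nat) : (1 <= l)%N ->
  'X * explicit_A l = (l`!%:R)^-1 *: ('X^l * (1 - 'X) ^+ l)^`(l - 1).
Proof.
(* With [l.+1] for [l], split [l.+1]! into [l.+1] times [l]!: the factorial [l]! normalises the
   derivative, and the remaining inverse is the prefactor in [explicit_A]. *)
case: l => // l _; rewrite subn1 /= factS natrM invfM -scalerA scale_derivn.
rewrite nderivn_Xn_1subX /explicit_A mulr_sumr scaler_sumr.
apply: eq_bigr => k _; rewrite -scalerAr -exprS scalerA mulrCA.
have -> : (l.+1 + k - l = k.+1)%N by rewrite addSnnS addKn.
(* Symmetry of binomials: ['C(l + k.+1, l)] equals ['C(l + k.+1, k.+1)]. *)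
by rewrite addSnnS -(bin_sub (leq_addr _ _)) addKn.
Qed.

Lemma explicit_B_derivn (l : nat) : (1 <= l)%N ->
  explicit_B l = ((l - 1)`!%:R)^-1 *: ('X^(l - 1) * (1 - 'X) ^+ l)^`(l - 1).
Proof.
case: l => // l _; rewrite scale_derivn nderivn_Xn_1subX subn1 /=.
apply: eq_bigr => k _; rewrite addKn addSn subn1 /=.
by rewrite -(bin_sub (leq_addr _ _)) addKn.
Qed.

(** The two derivatives match the two binomial products in each coefficient separately. *)
Lemma explicit_D_derivn (l : nat) : (3 <= l)%N ->
  explicit_D l =
    ((l - 2)`!%:R)^-1 *: ('X^(l - 2) * (1 - 'X) ^+ l)^`(l - 2)
    + ((l - 3)`!%:R)^-1 *: ('X^(l - 1) * (1 - 'X) ^+ (l - 2))^`(l - 3).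
Proof.
case: l => [|[|[|l]]] // _; rewrite !scale_derivn !nderivn_Xn_1subX.
rewrite !subSS !subn0 /explicit_D.
under eq_bigr do rewrite natrD mulrDr scalerDl.
rewrite big_split /=; congr (_ + _).
  apply: eq_bigr => k _; rewrite addKn !addSn !subSS subn0.
  by rewrite -addSn -(bin_sub (leq_addr _ _)) addKn.
(* The terms of index 0 and 1 vanish by the test [k < 2]. The others are reindexed by [k.+2], which
   keeps the sign and matches the derivative, whose lowest power is ['X^2]. *)
rewrite 2!big_ord_recl /= !mulr0 !scale0r !add0r.
apply: eq_bigr => k _; rewrite /bump /= !add1n !exprS !mulN1r opprK.
have -> : (l.+3 + k.+2 - 3 = l + k.+2)%N by rewrite !addSn !subSS subn0.
have -> : (l.+2 + k = l + k.+2)%N by rewrite !addSn !addnS.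
by rewrite addKn -!exprS -(bin_sub (leq_addr _ _)) addKn !subSS !subn0.
Qed.

Lemma derivn_D_combine (l : nat) : (3 <= l)%N ->
  ((l - 2)`!%:R)^-1 *: ('X^(l - 2) * (1 - 'X) ^+ l)^`(l - 2)
    + ((l - 3)`!%:R)^-1 *: ('X^(l - 1) * (1 - 'X) ^+ (l - 2))^`(l - 3)
  = ((l - 2)`!%:R)^-1 *:
      ('X^(l - 3) * (1 - 'X) ^+ (l - 2)
       * ((l - 2)%:R - (3 * l - 4)%:R * 'X
          + (3 * l - 4)%:R * 'X^2))^`(l - 3) :> {poly rat}.
Proof.
case: l => [|[|[|l]]] // _.
(* Truncated subtraction is removed so that [ring] can read the coefficient. *)
have -> : (3 * l.+3 - 4 = 3 * l + 5)%N by rewrite !mulnS [RHS]addnC.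
rewrite !subSS !subn0.
have -> : ((l`!)%:R^-1 = ((l.+1)`!)%:R^-1 * l.+1%:R :> rat).
  by rewrite factS natrM invfM mulrAC mulVf ?mul1r // Num.Theory.pnatr_eq0.
rewrite -scalerA -scalerDr -derivnZ derivSn -derivnD; congr (_ *: _^`(_)).
rewrite derivM derivXn deriv_exp /= derivB derivX -polyC1 derivC polyC1.
rewrite scaler_nat !exprS.
(* With the powers as atoms, and [n] the original [l], the common factor leaves [(n-2)(1-X)^2 -
   nX(1-X) + (n-2)X^2 = (n-2) - (3n-4)X + (3n-4)X^2]. *)
move: ('X^l) ((1 - 'X) ^+ l) => p q.
ring.
Qed.

(** The hypotheses supply the known explicit polynomials, which reduces every claim to an identity
    in [{poly rat}]. *)
Theorem theorem2p1
  (known_A : forall (l : nat), (1 <= l)%N ->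
     forall (gT : finGroupType) (s : 'I_l -> gT) (c : gT),
       coxeter_system (@cox_A l) s -> bipartite_coxeter_element s c ->
       skew_growth s c = explicit_A l)
  (known_B : forall (l : nat), (2 <= l)%N ->
     forall (gT : finGroupType) (s : 'I_l -> gT) (c : gT),
       coxeter_system (@cox_B l) s -> bipartite_coxeter_element s c ->
       skew_growth s c = explicit_B l)
  (known_D : forall (l : nat), (4 <= l)%N ->
     forall (gT : finGroupType) (s : 'I_l -> gT) (c : gT),
       coxeter_system (@cox_D l) s -> bipartite_coxeter_element s c ->
       skew_growth s c = explicit_D l) :
  [/\ (forall (l : nat), (1 <= l)%N ->
       forall (gT : finGroupType) (s : 'I_l -> gT) (c : gT),
         coxeter_system (@cox_A l) s -> bipartite_coxeter_element s c ->
         'X * skew_growth s c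
         = (l`!%:R)^-1 *: ('X^l * (1 - 'X) ^+ l)^`(l - 1)),
      (forall (l : nat), (2 <= l)%N ->
       forall (gT : finGroupType) (s : 'I_l -> gT) (c : gT),
         coxeter_system (@cox_B l) s -> bipartite_coxeter_element s c ->
         skew_growth s c
         = ((l - 1)`!%:R)^-1 *: ('X^(l - 1) * (1 - 'X) ^+ l)^`(l - 1))
    & (forall (l : nat), (4 <= l)%N ->
       forall (gT : finGroupType) (s : 'I_l -> gT) (c : gT),
         coxeter_system (@cox_D l) s -> bipartite_coxeter_element s c ->
         skew_growth s c
         = ((l - 2)`!%:R)^-1 *: ('X^(l - 2) * (1 - 'X) ^+ l)^`(l - 2)
           + ((l - 3)`!%:R)^-1 *: ('X^(l - 1) * (1 - 'X) ^+ (l - 2))^`(l - 3)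
         /\
         ((l - 2)`!%:R)^-1 *: ('X^(l - 2) * (1 - 'X) ^+ l)^`(l - 2)
           + ((l - 3)`!%:R)^-1 *: ('X^(l - 1) * (1 - 'X) ^+ (l - 2))^`(l - 3)
         = ((l - 2)`!%:R)^-1 *:
             ('X^(l - 3) * (1 - 'X) ^+ (l - 2)
              * ((l - 2)%:R - (3 * l - 4)%:R * 'X
                 + (3 * l - 4)%:R * 'X^2))^`(l - 3) :> {poly rat})].
Proof.
split=> l le_l gT s c sys cox.
- by rewrite (known_A l le_l gT s c sys cox) explicit_A_derivn.
- by rewrite (known_B l le_l gT s c sys cox) explicit_B_derivn // ltnW.
- rewrite (known_D l le_l gT s c sys cox).
  by split; [apply: explicit_D_derivn | apply: derivn_D_combine]; apply: ltnW.
Qed.
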